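(* Assume that $a$ and $b$ are Lipschitz in $x$ uniformly in $t$ and satisfy the linear growth bound $|a(s,x)|^2+\|b(s,x)\|_{\mathrm F}^2\le C_{\mathrm{lgb}}(1+|x|^2)$ for all $s\ge 0$, $x\in\mathbb R^d$. Assume moreover that: (i) the smallest eigenvalue $\sigma_0$ of $C_{Y_0}=\mathbb E[Y_0Y_0^\top]$ is strictly positive; (ii) there is a constant $\sigma_B>0$ such that $b(t,x)b(t,x)^\top\succeq \sigma_B I_{d\times d}$ for all $t$ and all $x\in\mathbb R^d$. Then, for any sequence of time steps $\{\Delta t_n\}_n$, $\Delta t_n=t_{n+1}-t_n>0$, the sequence $\{(U_n,Y_n)\}_n$ produced by the DLR Euler--Maruyama scheme satisfies, for all $n=0,\dots,N-1$, $$C_{Y_{n+1}}\succeq \sigma_B\,\Delta t_n\, I_{k\times k}.$$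
   Context: Setting. $(\Omega,\mathcal F,\mathbb P,(\mathcal F_t)_{t\ge 0})$ is a filtered complete probability space with the usual conditions, $W$ an $m$-dimensional $(\mathcal F_t)$-Brownian motion, $T>0$, $1\le k\le d$. The maps $a:[0,\infty)\times\mathbb R^d\to\mathbb R^d$ (drift) and $b:[0,\infty)\times\mathbb R^d\to\mathbb R^{d\times m}$ (diffusion) are Borel measurable. Notation. $|v|$ is the Euclidean norm of a vector, $\|A\|_{\mathrm F}$ the Frobenius norm of a matrix; $A\succeq B$ means $A-B$ is positive semidefinite. For $Y\in L^2(\Omega;\mathbb R^k)$, $C_Y:=\mathbb E[YY^\top]$. For $U\in\mathbb R^{k\times d}$ with orthonormal rows, $P_U:=U^\top U$. DLR Euler--Maruyama scheme. Given a grid $0=t_0<t_1<\dots<t_N=T$, $\Delta t_n=t_{n+1}-t_n$, $\Delta W_n=W(t_{n+1})-W(t_n)$, and initial data $U_0\in\mathbb R^{k\times d}$ with $U_0U_0^\top=I_{k\times k}$ and $Y_0\in L^2(\Omega;\mathbb R^k)$ $\mathcal F_0$-measurable, for $n=0,\dots,N-1$ set $$\tilde Y_{n+1}=Y_n+U_na(t_n,U_n^\top Y_n)\Delta t_n+U_nb(t_n,U_n^\top Y_n)\Delta W_n,$$ let $\tilde U_{n+1}$ solve $$C_{Y_n}\tilde U_{n+1}=C_{Y_n}U_n+\mathbb E[Y_na(t_n,U_n^\top Y_n)^\top](I_{d\times d}-P_{U_n})\Delta t_n$$ (a solution always exists; if $C_{Y_n}$ is singular take the one of minimal norm), compute the reduced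 QR decomposition $\tilde U_{n+1}^\top=U_{n+1}^\top R_{n+1}$, with $U_{n+1}U_{n+1}^\top=I_{k\times k}$ and $R_{n+1}\in\mathbb R^{k\times k}$ upper triangular (QR by Cholesky factorization or Gram--Schmidt, i.e. positive diagonal), and set $Y_{n+1}=R_{n+1}\tilde Y_{n+1}$, so that $U_{n+1}^\top Y_{n+1}=\tilde U_{n+1}^\top\tilde Y_{n+1}$. The approximation is $X_n=U_n^\top Y_n$. *)

(* Defs.v *)
From HB Require Import structures.
From mathcomp Require Import all_boot all_order all_algebra.
From mathcomp Require Import all_classical all_reals all_analysis.

Set Implicit Arguments.
Unset Strict Implicit.
Unset Printing Implicit Defensive.

Import Order.TTheory GRing.Theory Num.Theory.
Import numFieldNormedType.Exports.

Local Open Scope classical_set_scope.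
Local Open Scope ring_scope.

(* The library norm `|A| on matrices is the sup norm, hence this definition;
   on column vectors it is the Euclidean norm. *)
Definition normF {R : realType} {p q : nat} (A : 'M[R]_(p, q)) : R :=
  Num.sqrt (\sum_i \sum_j A i j ^+ 2).

Definition psdmx {R : realType} {p : nat} (A : 'M[R]_p) : Prop :=
  A^T = A /\ forall v : 'cV[R]_p, 0 <= (v^T *m A *m v) 0 0.

Definition loewner_ge {R : realType} {p : nat} (A B : 'M[R]_p) : Prop :=
  psdmx (A - B).

Definition smallest_eigenvalue {R : realType} {p : nat} (A : 'M[R]_p) (s : R)
    : Prop :=
  eigenvalue A s /\ forall l : R, eigenvalue A l -> s <= l.

Definition upper_triangular {R : realType} {p : nat} (A : 'M[R]_p) : Prop :=
  forall i j : 'I_p, (j < i)%N -> A i j = 0.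

(* Matrices with their Borel sigma-algebra, generated by the open sets. *)
Definition borelmx (R : realType) (p q : nat) :=
  g_sigma_algebraType (@open 'M[R]_(p, q)).

Section Probability.
Context {R : realType} {disp : measure_display} {Omega : measurableType disp}.
Variable P : probability Omega R.

Definition Emx {p q : nat} (Z : Omega -> 'M[R]_(p, q)) : 'M[R]_(p, q) :=
  \matrix_(i, j) fine ('E_P[fun w => Z w i j]).

(* C_Y is the second moment matrix: Y is not centred. *)
Definition C_ {k : nat} (Y : Omega -> 'cV[R]_k) : 'M[R]_k :=
  Emx (fun w => Y w *m (Y w)^T).

Definition measurable_wrt (G : set (set Omega)) {p q : nat}
    (Z : Omega -> 'M[R]_(p, q)) : Prop :=
  forall B : set (borelmx R p q), measurable B -> G (Z @^-1` B).

Definition L2 {k : nat} (Y : Omega -> 'cV[R]_k) : Prop :=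
  measurable_wrt measurable Y /\ ('E_P[fun w => (normF (Y w) ^+ 2)%R] < +oo)%E.

Definition filtration (F : R -> set (set Omega)) : Prop :=
  [/\ forall t : R, 0 <= t -> sigma_algebra [set: Omega] (F t),
      forall t : R, 0 <= t -> F t `<=` measurable &
      forall s t : R, 0 <= s -> s <= t -> F s `<=` F t].

Definition usual_conditions (F : R -> set (set Omega)) : Prop :=
  [/\ measure_is_complete P,
      P.-negligible `<=` F 0 &
      forall t : R, 0 <= t -> F t = \bigcap_(s in [set s | t < s]) F s].

(* The fourth clause says that W t - W s has law N(0, (t - s) I_m); the
   second parameter of [normal_prob] is the standard deviation. *)
Definition brownian_motion (F : R -> set (set Omega)) {m : nat}
    (W : R -> Omega -> 'cV[R]_m) : Prop :=
  [/\ forall t : R, 0 <= t -> measurable_wrt (F t) (W t),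
      {ae P, forall w, W 0 w = 0},
      forall s t : R, 0 <= s -> s < t ->
        forall (A : set Omega) (B : set (borelmx R m 1)), F s A -> measurable B ->
          P (A `&` [set w | B (W t w - W s w)%R]) =
          (P A * P [set w | B (W t w - W s w)%R])%E,
      forall s t : R, 0 <= s -> s < t ->
        forall B : 'I_m -> set R, (forall i, measurable (B i)) ->
          P [set w | forall i, B i ((W t w - W s w)%R i 0%R)] =
          (\prod_(i < m) normal_prob 0 (Num.sqrt (t - s)) (B i))%E &
      {ae P, forall w, {within [set t : R | 0 <= t], continuous (W ^~ w)}}].

End Probability.

Section Coefficients.
Context {R : realType} {d : nat}.

Definition borel_coef {p q : nat} (f : R -> 'cV[R]_d -> 'M[R]_(p, q)) : Prop :=
  measurable_fun ([set t : R | 0 <= t] `*` [set: borelmx R d 1])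
    (fun tx : R * borelmx R d 1 => f tx.1 tx.2 : borelmx R p q).

Definition lipschitz_coef {p q : nat} (f : R -> 'cV[R]_d -> 'M[R]_(p, q))
    : Prop :=
  exists L : R, forall (t : R) (x y : 'cV[R]_d), 0 <= t ->
    normF (f t x - f t y) <= L * normF (x - y).

End Coefficients.

Section Scheme.
Context {R : realType} {disp : measure_display} {Omega : measurableType disp}.
Variable P : probability Omega R.
Context {d m k : nat}.
Variables (a : R -> 'cV[R]_d -> 'cV[R]_d) (b : R -> 'cV[R]_d -> 'M[R]_(d, m)).
Variable W : R -> Omega -> 'cV[R]_m.

Definition Ytilde (t t' : R) (U : 'M[R]_(k, d)) (Y : Omega -> 'cV[R]_k)
    (w : Omega) : 'cV[R]_k :=
  Y w + (t' - t) *: (U *m a t (U^T *m Y w))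
      + U *m b t (U^T *m Y w) *m (W t' w - W t w).

Definition Utilde_eq (t t' : R) (U : 'M[R]_(k, d)) (Y : Omega -> 'cV[R]_k)
    (V : 'M[R]_(k, d)) : Prop :=
  C_ P Y *m V =
  C_ P Y *m U + (t' - t) *:
    (Emx P (fun w => Y w *m (a t (U^T *m Y w))^T) *m (1%:M - U^T *m U)).

Definition is_Utilde (t t' : R) (U : 'M[R]_(k, d)) (Y : Omega -> 'cV[R]_k)
    (V : 'M[R]_(k, d)) : Prop :=
  Utilde_eq t t' U Y V /\
  (C_ P Y \notin unitmx ->
   forall V', Utilde_eq t t' U Y V' -> normF V <= normF V').

(* A^T = Q^T Rm is the reduced QR decomposition of A^T. *)
Definition reduced_QR (A Q : 'M[R]_(k, d)) (Rm : 'M[R]_k) : Prop :=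
  [/\ A^T = Q^T *m Rm, Q *m Q^T = 1%:M, upper_triangular Rm &
      forall i, 0 < Rm i i].

Definition DLR_step (t t' : R) (U : 'M[R]_(k, d)) (Y : Omega -> 'cV[R]_k)
    (U' : 'M[R]_(k, d)) (Y' : Omega -> 'cV[R]_k) : Prop :=
  exists (V : 'M[R]_(k, d)) (Rm : 'M[R]_k),
    [/\ is_Utilde t t' U Y V, reduced_QR V U' Rm &
        forall w, Y' w = Rm *m Ytilde t t' U Y w].

Definition DLR_Euler_Maruyama (F : R -> set (set Omega)) (N : nat)
    (t : nat -> R) (U : nat -> 'M[R]_(k, d)) (Y : nat -> Omega -> 'cV[R]_k)
    : Prop :=
  [/\ U 0%N *m (U 0%N)^T = 1%:M, L2 P (Y 0%N), measurable_wrt (F 0) (Y 0%N) &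
      forall n, (n < N)%N ->
        DLR_step (t n) (t n.+1) (U n) (Y n) (U n.+1) (Y n.+1)].

End Scheme.

Definition time_grid {R : realType} (T : R) (N : nat) (t : nat -> R) : Prop :=
  [/\ t 0%N = 0, t N = T & forall n, (n < N)%N -> t n < t n.+1].

(* Main.v *)
Require Import Defs.
From mathcomp Require Import all_boot all_order all_algebra.
From mathcomp Require Import all_classical all_reals all_analysis.
From mathcomp Require Import measurable_realfun ring lra.

(* For v in R^k put u := R_{n+1}^T v. Since Delta W_n is centred, has covariance
   Delta t_n I_m and is independent of the past, the one-step Ito isometry gives
     v^T C_{Y_{n+1}} v = E[(u^T Ytilde_{n+1})^2]
       >= Delta t_n E|b^T U_n^T u|^2 >= sigma_B Delta t_n |u|^2.
   If C_{Y_n} is invertible, then Utilde_{n+1} = U_n + M with M U_n^T = 0, hence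
   R_{n+1}^T R_{n+1} = Utilde Utilde^T = I + M M^T; so R_{n+1}, and therefore also
   R_{n+1}^T, does not decrease norms, that is |u| >= |v|. Invertibility of C_{Y_n}
   is propagated by the bound itself, starting from sigma_0 > 0. *)

Set Implicit Arguments.
Unset Strict Implicit.
Unset Printing Implicit Defensive.

Import Order.TTheory GRing.Theory Num.Theory.
Import numFieldNormedType.Exports.

Local Open Scope classical_set_scope.
Local Open Scope ring_scope.

(** * Borel measurability of matrix-valued maps *)

(** Coordinates are continuous, which gives one direction. Conversely, an open set of matrices is a
    countable union of balls with rational centre, and a ball for the sup norm is a finite
    intersection of conditions on single entries. *)
Lemma measurable_mxP {d} {T : measurableType d} {R : realType} {p q : nat}
    (f : T -> 'M[R]_(p, q)) :
  measurable_fun [set: T] (f : T -> borelmx R p q) <->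
  forall i j, measurable_fun [set: T] (fun w => f w i j).
Proof.
split=> mf.
  move=> i j.
  have mc : measurable_fun [set: borelmx R p q] (fun M : 'M[R]_(p, q) => M i j).
    apply: (measurability _ (RGenOInfty.measurableE R)) =>
      _ [_ [x ->] <-]; rewrite setTI; apply: sub_sigma_algebra.
    by apply: open_comp => [M _|//]; exact: coord_continuous.
  exact: (measurableT_comp mc mf).
apply: (@measurability _ _ T (borelmx R p q) setT f (@open _) erefl).
move=> _ [A oA <-]; rewrite setTI.
(* A countable base: rational centres and radii [1 / (n + 1)]. *)
pose B (c : 'M[rat]_(p, q) * nat) : set 'M[R]_(p, q) :=
  ball (map_mx ratr c.1 : 'M[R]_(p, q)) c.2.+1%:R^-1.
have -> : f @^-1` A = \bigcup_(c in [set c | B c `<=` A]) (f @^-1` B c).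
  apply/seteqP; split=> [w Afw|w [c cA Bc]]; last exact: cA.
  have /nbhs_ballP[e /= e0 eA] := open_nbhs_nbhs (conj oA Afw).
  (* A ball of radius below [e / 2] that contains [f w] lies within distance [e] of [f w], hence
     inside [A]. *)
  have [n /= ne] : exists n : nat, n.+1%:R^-1 < e / 2.
    have e20 : 0 < e / 2 by rewrite divr_gt0.
    exists (Num.truncn (e / 2)^-1); rewrite invf_plt ?posrE ?ltr0n//.
    exact: truncnS_gt.
  have n0 : 0 < n.+1%:R^-1 :> R by rewrite invr_gt0 ltr0n.
  have /choice[c cP] : forall ij : 'I_p * 'I_q,
      exists r : rat, `|ratr r - f w ij.1 ij.2| < n.+1%:R^-1.
    move=> ij.
    have /rat_in_itvoo[r] :
        f w ij.1 ij.2 - n.+1%:R^-1 < f w ij.1 ij.2 + n.+1%:R^-1.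
      by rewrite ltrD2l gtrN.
    rewrite in_itv/= => rP; exists r; rewrite ltr_distl; exact: rP.
  exists (\matrix_(i, j) c (i, j), n) => [M [_ Mb]|]; last first.
    by split=> //= i j; rewrite !mxE; exact: (cP (i, j)).
  apply: eA; split=> // i j.
  have := Mb i j; rewrite !mxE /ball/= => cM.
  have := cP (i, j); rewrite distrC /= => cf.
  rewrite (le_lt_trans (ler_distD (ratr (c (i, j))) _ _))// [ltRHS]splitr.
  by rewrite ltrD// (lt_trans _ ne).
rewrite bigcup_mkcond; apply: countable_bigcupT_measurable => [|c].
  exact: countableP.
case: ifP => // _.
have -> : f @^-1` B c =
    \bigcap_(ij in [set: 'I_p * 'I_q])
      (fun w => f w ij.1 ij.2) @^-1` ball (ratr (c.1 ij.1 ij.2) : R) c.2.+1%:R^-1.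
  apply/seteqP; split=> [w [_ Bw] ij _ /=|w Bw].
    by have := Bw ij.1 ij.2; rewrite mxE.
  split=> [|i j]; first by rewrite invr_gt0 ltr0n.
  by rewrite mxE; exact: (Bw (i, j) I).
apply: fin_bigcap_measurable => [|ij _]; first exact: finite_finset.
rewrite -[X in measurable X]setTI; apply: mf => //.
exact: measurable_ball.
Qed.

(** * Independence and product expectations *)

(** Independence says that the joint law and the product of the marginal laws agree on rectangles,
    hence everywhere; Fubini for the function [x y] does the rest. Integrability of the product is
    part of the conclusion: for merely integrable factors it comes from independence. *)
Lemma expectationM_indep {d} {T : measurableType d} {R : realType}
    (P : probability T R) (X Y : T -> R) :
  (forall A B : set R, measurable A -> measurable B ->
     P (X @^-1` A `&` Y @^-1` B) = (P (X @^-1` A) * P (Y @^-1` B))%E) ->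
  X \in Lfun P 1 -> Y \in Lfun P 1 ->
  X \* Y \in Lfun P 1 /\ ('E_P[X \* Y] = 'E_P[X] * 'E_P[Y])%E.
Proof.
move=> XYind X1 Y1.
have mX : measurable_fun [set: T] X by have /set_mem := sub_Lfun_mfun X1.
have mY : measurable_fun [set: T] Y by have /set_mem := sub_Lfun_mfun Y1.
have mXY := measurable_fun_pair mX mY.
pose X' : {mfun T >-> R} := mfun_Sub (mem_set mX).
pose Y' : {mfun T >-> R} := mfun_Sub (mem_set mY).
pose XY' : {mfun T >-> (R * R)%type} := mfun_Sub (mem_set mXY).
have jointE (A : set (R * R)) : measurable A ->
    (distribution P X' \x distribution P Y')%E A = distribution P XY' A.
  by apply: product_measure_unique => A1 A2 mA1 mA2; exact: XYind.
pose h (z : R * R) := (z.1 * z.2)%:E.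
have mh : measurable_fun [set: R * R] h.
  by apply/measurable_EFinP; apply: measurable_funM.
have iX1 : P.-integrable [set: T] (EFin \o X) by exact/Lfun1_integrable.
have iY1 : P.-integrable [set: T] (EFin \o Y) by exact/Lfun1_integrable.
have iX : (distribution P X').-integrable [set: R] (EFin \o id).
  by apply: integrable_pushforward => //; exact/measurable_EFinP.
have iY : (distribution P Y').-integrable [set: R] (EFin \o id).
  by apply: integrable_pushforward => //; exact/measurable_EFinP.
(* Tonelli: the iterated integral of [|x| |y|] is the product of the two first absolute moments. *)
have ih : (distribution P X' \x distribution P Y')%E.-integrable setT h.
  apply/integrable12ltyP => //.
  under eq_integral => x _.
    under eq_integral do rewrite /h/= normrM EFinM.
    rewrite ge0_integralZl//; last first.
      by apply/measurable_EFinP; exact: normr_measurable.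
    over.
  rewrite ge0_integralZr//; last 2 first.
  - by apply/measurable_EFinP; exact: normr_measurable.
  - by apply: integral_ge0.
  move/integrableP : iX => [_ iX]; move/integrableP : iY => [_ iY].
  by rewrite lte_mul_pinfty ?integral_ge0// ge0_fin_numE ?integral_ge0.
have XY1 : X \* Y \in Lfun P 1.
  apply/Lfun1_integrable/integrableP; split.
    by apply/measurable_EFinP; exact: measurable_funM.
  move/integrableP : ih => [_]; apply: le_lt_trans.
  rewrite [leRHS](eq_measure_integral (distribution P XY')) => [|A mA _].
    by rewrite ge0_integral_distribution//; exact: measurableT_comp.
  exact: jointE.
split=> //; rewrite unlock.
transitivity (\int[distribution P XY']_z h z)%E.
  by rewrite integral_distribution//; exact/Lfun1_integrable.
rewrite [LHS](eq_measure_integral (distribution P X' \x distribution P Y')%E)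
  => [|A mA _].
  rewrite -integral12_prod_meas1//=.
  under eq_integral => x _.
    rewrite /fubini_F; under eq_integral do rewrite /h/= EFinM.
    rewrite integralZl//.
    over.
  have e2fin : (\int[distribution P Y']_y y%:E)%E \is a fin_num.
    exact: integrable_fin_num.
  rewrite -(fineK e2fin) integralZr// fineK//.
  by rewrite !(@integral_distribution _ _ _ _ _ _ _ EFin).
exact/esym/jointE.
Qed.

(** * Moments of the centred normal law *)

(** The density [g] and the Radon-Nikodym derivative of [nu] have the same integral over every
    measurable set, so they agree almost everywhere, and the change of variables for the derivative
    passes to [g]. *)
Lemma ge0_integral_density {d} {T : measurableType d} {R : realType}
    (nu : {finite_measure set T -> \bar R})
    (mu : {sigma_finite_measure set T -> \bar R}) (g f : T -> \bar R) :
  (forall A, measurable A -> nu A = \int[mu]_(x in A) g x)%E ->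
  measurable_fun [set: T] g ->
  measurable_fun [set: T] f -> (forall x, 0 <= f x)%E ->
  (\int[nu]_x f x = \int[mu]_x (f x * g x))%E.
Proof.
move=> nuE mg mf f0.
have numu : nu `<< mu.
  apply/null_content_dominatesP => A mA muA0.
  by rewrite nuE// null_set_integral//; exact: measurable_funTS.
have mRN : measurable_fun [set: T] (Radon_Nikodym_SigmaFinite.f nu mu).
  exact: measurable_int (Radon_Nikodym_SigmaFinite.f_integrable _).
rewrite -(Radon_Nikodym_SigmaFinite.change_of_variables numu)//.
apply: ae_eq_integral => //; [exact: emeasurable_funM..|].
apply: ae_eqe_mul2l; apply: integral_ae_eq => //.
  exact: Radon_Nikodym_SigmaFinite.f_integrable.
by move=> A _ mA; rewrite -nuE// -Radon_Nikodym_SigmaFinite.f_integral.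
Qed.

Section normal_moments.
Context {R : realType} (s : R).
Hypothesis s0 : 0 < s.
Let mu := @lebesgue_measure R.
Let phi : R -> R := normal_pdf 0 s.

Let phiE : phi = fun x => normal_peak s * expR (- x ^+ 2 / (s ^+ 2 *+ 2)).
Proof.
apply/funext => x; rewrite /phi normal_pdfE ?gt_eqF// /normal_fun subr0.
by [].
Qed.

Let cphi : continuous phi.
Proof. by apply: continuous_normal_pdf; rewrite gt_eqF. Qed.

Let F (x : R) : R := - (s ^+ 2 * x * phi x).

Let dF (x : R) : is_derive x 1 F ((x ^+ 2 - s ^+ 2) * phi x).
Proof.
rewrite /F phiE; apply: is_derive_eq; rewrite /GRing.scale/=.
have s2 : s != 0 by rewrite gt_eqF.
by rewrite -[in RHS](mulr_natr (s ^+ 2)) -mulr_natr; field.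
Qed.

Let cF : continuous F.
Proof.
move=> x; apply: differentiable_continuous.
by apply/derivable1_diffP; exact: ex_derive.
Qed.

Let F_cvg0 : F x @[x --> +oo%R] --> (0 : R).
Proof.
rewrite -oppr0; apply: cvgN.
(* From [y <= 1 + y <= expR y] at [y = x^2 / (2 s^2)] follows [x exp(- x^2 / (2 s^2)) <= 2 s^2 / x];
   the remaining factors of [- F] complete the constant. *)
pose c : R := s ^+ 2 * normal_peak s * (s ^+ 2 *+ 2).
apply: (@squeeze_cvgr _ _ _ _ (cst 0) (fun x => c * x^-1)).
- near=> x.
  have x0 : 0 < x by near: x; exact: nbhs_pinfty_gt.
  apply/andP; split.
    by rewrite !mulr_ge0 ?normal_pdf_ge0 ?sqr_ge0// ltW.
  have c'0 : 0 < s ^+ 2 *+ 2 by rewrite mulrn_wgt0// exprn_gt0.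
  have -> : s ^+ 2 * x * phi x =
      s ^+ 2 * normal_peak s * (x * expR (- x ^+ 2 / (s ^+ 2 *+ 2))).
    by rewrite phiE; ring.
  rewrite /c -[leRHS]mulrA ler_wpM2l//.
    by rewrite mulr_ge0 ?sqr_ge0 ?normal_peak_ge0.
  rewrite mulNr expRN ler_pdivlMr// mulrAC -expr2.
  rewrite ler_pdivrMr ?expR_gt0// mulrC -ler_pdivrMr//.
  by rewrite (le_trans _ (expR_ge1Dx _))// lerDr.
- exact: cvg_cst.
- rewrite -[X in _ --> X](mulr0 c); apply: cvgM; first exact: cvg_cst.
  apply/(gtr0_cvgV0 _).2; last exact: cvg_id.
  exact: nbhs_pinfty_gt.
Unshelve. all: by end_near. Qed.

Let cx2 : continuous (fun x : R => x ^+ 2 - s ^+ 2).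
Proof.
by move=> x; apply: cvgB; [exact: exprn_continuous|exact: cvg_cst].
Qed.

Let cs2 : continuous (fun x : R => s ^+ 2 - x ^+ 2).
Proof.
by move=> x; apply: cvgB; [exact: cvg_cst|exact: exprn_continuous].
Qed.

Let c : R := s ^+ 3 * phi s.

(** The integrand is nonnegative from [s] on, as the fundamental theorem of calculus on a half-line
    requires; [F] vanishes at infinity, which leaves [- F s]. *)
Let tail_integral :
  (\int[mu]_(x in `[s, +oo[) ((x ^+ 2 - s ^+ 2) * phi x)%:E = c%:E)%E.
Proof.
rewrite (@ge0_continuous_FTC2y _ _ F s 0).
- by rewrite -EFinB sub0r opprK /c; congr (_%:E); ring.
- move=> x sx; rewrite mulr_ge0 ?normal_pdf_ge0// subr_ge0.
  by rewrite lerXn2r ?nnegrE// ltW// (lt_le_trans s0).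
- by apply: continuous_subspaceT => x; apply: cvgM; [exact: cx2|exact: cphi].
- exact: F_cvg0.
- by move=> x _; exact: ex_derive.
- exact/cvg_at_right_filter/cF.
- by move=> x _; rewrite derive1E; case: (dF x).
Qed.

(** The sign is reversed to keep the integrand nonnegative on this interval. *)
Let head_integral :
  (\int[mu]_(x in `[0%R, s]) ((s ^+ 2 - x ^+ 2) * phi x)%:E = c%:E)%E.
Proof.
have dNF (x : R) : is_derive x 1 (- F) ((s ^+ 2 - x ^+ 2) * phi x).
  have -> : (s ^+ 2 - x ^+ 2) * phi x = - ((x ^+ 2 - s ^+ 2) * phi x) by ring.
  have := dF x; exact: is_deriveN.
have cNF : continuous (- F) by move=> x; apply: cvgN; exact: cF.
rewrite (@continuous_FTC2 _ _ (- F)).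
- have NFE (y : R) : (- F) y = s ^+ 2 * y * phi y by exact: opprK.
  by rewrite !NFE -EFinB /c; congr (_%:E); ring.
- exact: s0.
- by apply: continuous_subspaceT => x; apply: cvgM; [exact: cs2|exact: cphi].
- split => [x _||]; first exact: ex_derive.
  + exact/cvg_at_right_filter/cNF.
  + exact/cvg_at_left_filter/cNF.
- by move=> x _; rewrite derive1E; case: (dNF x).
Qed.

Let mMphi (A : set R) (p : R -> R) :
  continuous p -> measurable_fun A (fun x : R => (p x * phi x)%:E).
Proof.
move=> cp; apply/measurable_funTS/measurable_EFinP; apply: measurable_funM.
  exact: continuous_measurable_fun.
exact: measurable_normal_pdf.
Qed.

(* F is an antiderivative of (x^2 - s^2) phi, which changes sign only at s: its
   integrals over [0, s] and [s, +oo[ are -c and c, so int x^2 phi = s^2 int phi. *)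
Lemma integral_sqr_normal_pdf :
  (\int[mu]_x (x ^+ 2 * phi x)%:E = (s ^+ 2)%:E)%E.
Proof.
have phi_ge0 x : 0 <= phi x by exact: normal_pdf_ge0.
have s2phi_ge0 x : (0 <= (s ^+ 2 * phi x)%:E)%E.
  by rewrite lee_fin mulr_ge0 ?sqr_ge0.
have x2phi_ge0 x : (0 <= (x ^+ 2 * phi x)%:E)%E.
  by rewrite lee_fin mulr_ge0 ?sqr_ge0.
(* This equality and the next are sums of nonnegative terms, so nothing is subtracted in the
   extended reals and integrability need not be known beforehand. *)
have eqt : (\int[mu]_(x in `[s, +oo[) (x ^+ 2 * phi x)%:E =
    c%:E + \int[mu]_(x in `[s, +oo[) (s ^+ 2 * phi x)%:E)%E.
  rewrite -tail_integral -ge0_integralD//=.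
  - by apply: eq_integral => x _; rewrite -EFinD -mulrDl subrK.
  - move=> x; rewrite in_itv/= andbT => sx.
    by rewrite lee_fin mulr_ge0// subr_ge0 lerXn2r ?nnegrE// ltW// (lt_le_trans s0).
  - exact: mMphi.
  - by apply: mMphi; exact: cst_continuous.
have eqh : (\int[mu]_(x in `[0%R, s]) (s ^+ 2 * phi x)%:E =
    c%:E + \int[mu]_(x in `[0%R, s]) (x ^+ 2 * phi x)%:E)%E.
  rewrite -head_integral -ge0_integralD//=.
  - by apply: eq_integral => x _; rewrite -EFinD -mulrDl subrK.
  - move=> x; rewrite in_itv/= => /andP[x0 xs].
    by rewrite lee_fin mulr_ge0// subr_ge0 lerXn2r ?nnegrE// ltW.
  - exact: mMphi.
  - by apply: mMphi; exact: exprn_continuous.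
(* Evenness reduces the line to the half-line, which is then cut at [s], where [x^2 - s^2] changes
   sign. *)
have half (p : R -> R) : continuous p -> (forall x, 0 <= p x) ->
    (forall x, p x = p (- x)) ->
    (\int[mu]_x (p x * phi x)%:E =
     2%:E * (\int[mu]_(x in `[0%R, s]) (p x * phi x)%:E +
             \int[mu]_(x in `[s, +oo[) (p x * phi x)%:E))%E.
  move=> cp p0 pN.
  rewrite ge0_symfun_integralT//=.
  - congr (_ * _)%E; rewrite -set_itvcy.
    rewrite (@itv_bndbnd_setU _ _ _ (BRight s))//= ?bnd_simp ?ltW//.
    rewrite ge0_integral_setU//=.
    + by rewrite integral_itv_obnd_cbnd//; exact: mMphi.
    + exact: mMphi.
    + by move=> x _; rewrite lee_fin mulr_ge0.
    + apply/disj_setPS => x /=; rewrite !in_itv/= andbT => -[/andP[_ xs]].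
      by move/(le_lt_trans xs); rewrite ltxx.
  - by move=> x; rewrite mulr_ge0.
  - by move=> x; apply: cvgM; [exact: cp|exact: cphi].
  - by move=> x /=; rewrite -pN phiE sqrrN.
rewrite half; last 3 first.
- exact: exprn_continuous.
- exact: sqr_ge0.
- by move=> x; rewrite sqrrN.
(* The constant [c] released by the tail is absorbed by the head: both pieces now carry [s^2 phi],
   and [half] is read backwards. *)
rewrite eqt addeA (addeC _ c%:E) -eqh -(half (fun=> s ^+ 2)); last 3 first.
- by move=> x; exact: cvg_cst.
- by move=> x; exact: sqr_ge0.
- by [].
under eq_integral do rewrite EFinM.
rewrite ge0_integralZl//=; last 3 first.
- by apply/measurable_EFinP; exact: measurable_normal_pdf.
- by move=> x _; rewrite lee_fin.
- by rewrite lee_fin sqr_ge0.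
by rewrite integral_normal_pdf mule1.
Qed.

Lemma integral_sqr_normal_prob :
  (\int[normal_prob 0 s]_x (x ^+ 2)%:E = (s ^+ 2)%:E)%E.
Proof.
rewrite (@ge0_integral_density _ _ _ _ mu (fun x => (phi x)%:E)) => [| | | |x].
- exact: integral_sqr_normal_pdf.
- by [].
- by apply/measurable_EFinP; exact: measurable_normal_pdf.
- by apply/measurable_EFinP; exact: measurable_funX.
- by rewrite lee_fin sqr_ge0.
Qed.

(** The density is even and Lebesgue measure is invariant under negation. This is what makes the
    mean vanish. *)
Lemma normal_probN (A : set R) : measurable A ->
  normal_prob 0 s (-%R @^-1` A) = normal_prob 0 s A.
Proof.
move=> mA; rewrite /normal_prob.
under eq_integral => x _.
  have -> : normal_pdf 0 s x = phi (- x) by rewrite -/(phi x) phiE sqrrN.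
  over.
rewrite (_ : -%R @^-1` A =
  (-%R : measurableTypeR R -> measurableTypeR R) @^-1` A)//.
rewrite -(ge0_integral_pushforward _ lebesgue_measure
  (f := fun x : measurableTypeR R => (phi x)%:E))//=.
- rewrite -[normal_pdf 0 s]/phi; apply/esym.
  by apply: eq_measure_integral => //= B mB _; exact/esym/lebesgue_measureN.
- by apply/measurable_funTS/measurable_EFinP; exact: measurable_normal_pdf.
- by move=> y _; rewrite lee_fin normal_pdf_ge0.
Qed.

End normal_moments.

(** * Square-integrable random variables *)

Section L2_expectation.
Context {d} {T : measurableType d} {R : realType} (P : probability T R).
Implicit Types f g : T -> R.

(** [fine] sends infinite values to 0, hence the integrability hypotheses of the linearity lemmas
    below. *)
Definition Er f : R := fine 'E_P[f].

Lemma Lfun_measurable (p : \bar R) f : f \in Lfun P p -> measurable_fun [set: T] f.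
Proof. by move=> /sub_Lfun_mfun/set_mem. Qed.

Lemma Lfun2_subset_Lfun1 f : f \in Lfun P 2%:E -> f \in Lfun P 1.
Proof. by apply: Lfun_subset12; exact: fin_num_measure. Qed.

(** Serves twice: for the coefficients, dominated through the linear growth bound, and for products
    of a past variable with an increment. *)
Lemma Lfun2_dominated f g : measurable_fun [set: T] f ->
  (forall w, f w ^+ 2 <= g w) -> g \in Lfun P 1 -> f \in Lfun P 2%:E.
Proof.
move=> mf fg /Lfun1_integrable/integrableP[mg ig].
rewrite inE; apply/andP; split; rewrite inE//= /finite_norm unlock /Lnorm.
rewrite poweR_lty//; apply: le_lt_trans ig.
apply: ge0_le_integral => //=.
- apply/measurable_EFinP.
  apply/(@measurableT_comp _ _ _ _ _ _ (fun x : R => x `^ 2)) => //.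
  exact/measurableT_comp.
- apply/measurable_EFinP/measurableT_comp => //; exact/measurable_EFinP.
- move=> w _; rewrite lee_fin powR_mulrn// real_normK ?num_real//.
  by rewrite (le_trans (fg w))// ler_norm.
Qed.

Lemma Lfun2_sqr f : measurable_fun [set: T] f ->
  f \in Lfun P 2%:E <-> (f \* f) \in Lfun P 1.
Proof.
move=> mf; split=> [f2|ff1]; first exact: Lfun2_mul_Lfun1.
exact: (@Lfun2_dominated f (f \* f)).
Qed.

Lemma Lfun_sum (I : finType) (p : R) (h : I -> T -> R) : 1 <= p ->
  (forall i, h i \in Lfun P p%:E) -> (fun w => \sum_i h i w) \in Lfun P p%:E.
Proof.
move=> p1 hp.
have -> : (fun w => \sum_i h i w) = \sum_i h i by apply/funext => w; rewrite fct_sumE.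
have p1' : (1 <= p%:E)%E by rewrite lee_fin.
by apply: (big_ind (fun f => f \in Lfun P p%:E)) => // [|f g fp gp];
  [exact: (rpred0 (Lfun P p%:E))|exact: rpredD].
Qed.

Lemma LfunD (p : R) f g : 1 <= p -> f \in Lfun P p%:E -> g \in Lfun P p%:E ->
  (fun w => f w + g w) \in Lfun P p%:E.
Proof. by move=> p1 fp gp; have p1' : (1 <= p%:E)%E by []; exact: rpredD. Qed.

Lemma ErD f g : f \in Lfun P 1 -> g \in Lfun P 1 ->
  Er (fun w => f w + g w) = Er f + Er g.
Proof.
by move=> f1 g1; rewrite /Er expectationD// fineD// expectation_fin_num.
Qed.

Lemma ErZ (c : R) f : f \in Lfun P 1 -> Er (fun w => c * f w) = c * Er f.
Proof.
move=> f1; rewrite /Er; have -> : (fun w => c * f w) = c \o* f.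
  by apply/funext => w; rewrite /= mulrC.
by rewrite expectationZl// fineM// expectation_fin_num.
Qed.

Lemma LfunZ (p c : R) f : 1 <= p -> f \in Lfun P p%:E ->
  (fun w => c * f w) \in Lfun P p%:E.
Proof.
move=> p1 fp; have -> : (fun w => c * f w) = c \o* f.
  by apply/funext => w; rewrite /= mulrC.
exact: Lfun_scale.
Qed.

Lemma Er_sum (I : finType) (h : I -> T -> R) :
  (forall i, h i \in Lfun P 1) -> Er (fun w => \sum_i h i w) = \sum_i Er (h i).
Proof.
move=> h1.
have -> : (fun w => \sum_i h i w) = \sum_i h i by apply/funext => w; rewrite fct_sumE.
(* Integrability travels with the value, since additivity of [Er] needs it at each partial sum. *)
pose K (f : T -> R) (r : R) := f \in Lfun P 1 /\ Er f = r.
suff [] : K (\sum_i h i) (\sum_i Er (h i)) by [].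
apply: (big_ind2 K) => [|f r g s [f1 <-] [g1 <-]|i _]; last by split.
- by split; [exact: (Lfun_cst P 0 1)|rewrite /Er expectation_cst].
- by split; [exact: rpredD|exact: ErD].
Qed.

Lemma Er_ge0 f : (forall w, 0 <= f w) -> 0 <= Er f.
Proof. by move=> f0; rewrite /Er fine_ge0// expectation_ge0. Qed.

Lemma Er_le f g : f \in Lfun P 1 -> g \in Lfun P 1 -> (forall w, f w <= g w) ->
  Er f <= Er g.
Proof.
move=> f1 g1 fg; rewrite -subr_ge0 -mulN1r -ErZ// -ErD//; last exact: LfunZ.
by apply: Er_ge0 => w; rewrite mulN1r subr_ge0.
Qed.

Lemma ErM_indep f g :
  (forall A B : set R, measurable A -> measurable B ->
     P (f @^-1` A `&` g @^-1` B) = (P (f @^-1` A) * P (g @^-1` B))%E) ->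
  f \in Lfun P 1 -> g \in Lfun P 1 -> f \* g \in Lfun P 1 /\ Er (f \* g) = Er f * Er g.
Proof.
move=> fg f1 g1; have [fg1 E] := expectationM_indep fg f1 g1; split=> //.
by rewrite /Er E fineM// expectation_fin_num.
Qed.

Lemma normal_law_moments (s : R) f : 0 < s -> measurable_fun [set: T] f ->
  (forall B : set R, measurable B -> P (f @^-1` B) = normal_prob 0 s B) ->
  [/\ f \in Lfun P 2%:E, Er f = 0 & Er (f \* f) = s ^+ 2].
Proof.
move=> s0 mf fE.
have mf' : @measurable_fun _ _ T (measurableTypeR R) [set: T] f by exact: mf.
pose f' : {mfun T >-> measurableTypeR R} :=
  @mfun_Sub _ _ T (measurableTypeR R) f (mem_set mf').
have Eff : ('E_P[f \* f] = (s ^+ 2)%:E)%E.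
  rewrite unlock -(integral_sqr_normal_prob s0).
  transitivity (\int[distribution P f']_x (x ^+ 2)%:E)%E; last first.
    by apply: eq_measure_integral => B mB _; exact: fE.
  rewrite ge0_integral_distribution// => [|x]; last by rewrite lee_fin sqr_ge0.
  by apply/measurable_EFinP; exact: measurable_funX.
have f2 : f \in Lfun P 2%:E.
  apply/Lfun2_sqr => //; apply/Lfun1_integrable/integrableP; split.
    by apply/measurable_EFinP; exact: measurable_funM.
  move: Eff; rewrite unlock => Eff.
  under eq_integral do rewrite gee0_abs ?lee_fin ?sqr_ge0//.
  by rewrite Eff ltry.
have f1 := Lfun2_subset_Lfun1 f2.
split=> //; last by rewrite /Er Eff.
have Nf1 := LfunZ (-1) (lexx 1) f1.
(* By symmetry of the normal law, [f] and [- f] have the same distribution, hence the same mean. *)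
suff : Er f = - Er f by lra.
rewrite -mulN1r -ErZ//; congr fine; rewrite unlock.
pose Nf' : {mfun T >-> R} := mfun_Sub (mem_set (Lfun_measurable Nf1)).
pose f'' : {mfun T >-> R} := mfun_Sub (mem_set mf).
transitivity (\int[distribution P f'']_x x%:E)%E.
  by rewrite integral_distribution//; exact/Lfun1_integrable.
transitivity (\int[distribution P Nf']_x x%:E)%E; last first.
  by rewrite integral_distribution//; exact/Lfun1_integrable.
apply: eq_measure_integral => B mB _.
rewrite [LHS]fE// -normal_probN// -fE; last first.
  by rewrite -[X in measurable X]setTI; exact: oppr_measurable.
by congr (P _); apply/seteqP; split=> w /=; rewrite mulN1r.
Qed.

End L2_expectation.

(** * Brownian increments *)

Lemma g_sigma_measurable {T : Type} (G : set (set T)) (A : set T) :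
  sigma_algebra [set: T] G -> <<s G >> A <-> G A.
Proof. by move=> sG; rewrite sigma_algebra_id. Qed.

(** Turns adaptedness into ordinary measurability of the entries on the type generated by [G]; as
    [G] is a sigma-algebra, generation adds no new sets. *)
Lemma measurable_wrtP {R : realType} {d} {T : measurableType d}
    (G : set (set T)) {p q : nat} (Z : T -> 'M[R]_(p, q)) :
  sigma_algebra [set: T] G ->
  measurable_wrt G Z <->
  forall i j, measurable_fun [set: g_sigma_algebraType G] (fun w => Z w i j).
Proof.
move=> sG.
rewrite -(@measurable_mxP _ (g_sigma_algebraType G)); split=> [mZ _ B mB|mZ B mB].
  by rewrite setTI; apply: sub_sigma_algebra; exact: mZ.
by apply/g_sigma_measurable => //; rewrite -[X in <<s _ >> X]setTI; exact: mZ.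
Qed.

Lemma measurable_fun_sub_sigma {d d'} {T : measurableType d} {U : measurableType d'}
    (G : set (set T)) (f : T -> U) : G `<=` measurable ->
  measurable_fun [set: g_sigma_algebraType G] f -> measurable_fun [set: T] f.
Proof.
move=> GT mf _ B mB; have := mf measurableT B mB.
exact: (smallest_sub (@sigma_algebra_measurable _ T) GT).
Qed.

Lemma measurable_fun_mono_sigma {d d'} {T : measurableType d} {U : measurableType d'}
    (G G' : set (set T)) (f : T -> U) : G `<=` G' ->
  measurable_fun [set: g_sigma_algebraType G] f ->
  measurable_fun [set: g_sigma_algebraType G'] f.
Proof.
move=> GG' mf _ B mB; have := mf measurableT B mB.
exact: sub_sigma_algebra2.
Qed.

Section increments.
Context {R : realType} {d} {T : measurableType d} (P : probability T R).
Context (F : R -> set (set T)) {m : nat} (W : R -> T -> 'cV[R]_m).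
Hypotheses (hF : filtration F) (hW : brownian_motion P F W).
Context (s t : R) (s0 : 0 <= s) (st : s < t).

Let sF (r : R) : 0 <= r -> sigma_algebra [set: T] (F r).
Proof. by case: hF => + _ _; exact. Qed.

Let t0 : 0 <= t. Proof. exact: le_trans s0 (ltW st). Qed.

Let dW (w : T) : 'cV[R]_m := W t w - W s w.

Let xi (j : 'I_m) (w : T) : R := (W t w - W s w) j 0.

Lemma measurable_increment j :
  measurable_fun [set: g_sigma_algebraType (F t)] (fun w => (W t w - W s w) j 0).
Proof.
case: hW => mW _ _ _ _; case: hF => _ _ incF.
have mWt := (measurable_wrtP (W t) (sF t0)).1 (mW _ t0) j 0.
have mWs := (measurable_wrtP (W s) (sF s0)).1 (mW _ s0) j 0.
have mWst := measurable_fun_mono_sigma (incF _ _ s0 (ltW st)) mWs.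
under eq_fun do rewrite !mxE.
exact: measurable_funB.
Qed.

Let mxi j : measurable_fun [set: T] (xi j).
Proof.
apply: measurable_fun_sub_sigma (measurable_increment j).
by case: hF => _ + _; exact.
Qed.

Lemma increment_law j (B : set R) : measurable B ->
  P (xi j @^-1` B) = normal_prob 0 (Num.sqrt (t - s)) B.
Proof.
move=> mB; case: hW => _ _ _ /(_ _ _ s0 st) law _.
(* The other coordinates are left unconstrained and contribute a factor 1 to the product law. *)
pose D i := if i == j then B else setT.
have /law : forall i, measurable (D i) by rewrite /D => i; case: ifP.
rewrite (bigD1 j)//= big1 /D ?eqxx ?mule1 => [|i /negbTE ->]; last first.
  exact: probability_setT.
move=> <-; congr (P _); apply/seteqP; split=> w /= => [Bw i|/(_ j)]; last first.
  by rewrite eqxx.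
by case: eqP => // ->.
Qed.

Lemma increments_indep j l (A B : set R) : j != l -> measurable A -> measurable B ->
  P (xi j @^-1` A `&` xi l @^-1` B) = (P (xi j @^-1` A) * P (xi l @^-1` B))%E.
Proof.
move=> jl mA mB; rewrite !increment_law//.
case: hW => _ _ _ /(_ _ _ s0 st) law _.
have lj : (l == j) = false by apply/negbTE; rewrite eq_sym.
pose D i := if i == j then A else if i == l then B else setT.
have /law : forall i, measurable (D i).
  by rewrite /D => i; case: ifP => // _; case: ifP.
rewrite (bigD1 j)//= (bigD1 l) ?lj//= big1 /D ?eqxx ?lj ?mule1; last first.
  by move=> i /andP[/negbTE -> /negbTE ->]; exact: probability_setT.
move=> <-; congr (P _); apply/seteqP; split=> w /= => [[Aw Bw] i|h].
  by case: eqP => [->//|_]; case: eqP => [->//|].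
by have := h j; have := h l; rewrite !eqxx lj.
Qed.

(** A general function [g] of the whole increment is allowed because both single coordinates and
    products of two coordinates are needed. *)
Lemma increment_indep_past (f : T -> R) (g : 'cV[R]_m -> R) (A B : set R) :
  measurable_fun [set: g_sigma_algebraType (F s)] f ->
  measurable_fun [set: borelmx R m 1] g ->
  measurable A -> measurable B ->
  P (f @^-1` A `&` (g \o dW) @^-1` B) =
  (P (f @^-1` A) * P ((g \o dW) @^-1` B))%E.
Proof.
move=> mf mg mA mB; case: hW => _ _ /(_ _ _ s0 st) ind _ _.
apply: (ind _ (g @^-1` B)).
  by apply/(g_sigma_measurable _ (sF s0)); rewrite -[X in <<s _ >> X]setTI; exact: mf.
by rewrite -[X in measurable X]setTI; exact: mg.
Qed.

Let moments j := normal_law_moments (etrans (sqrtr_gt0 _) (etrans (subr_gt0 _ _) st))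
  (mxi j) (@increment_law j).

Lemma increment_Lfun2 j : xi j \in Lfun P 2%:E.
Proof. by case: (moments j). Qed.

Lemma increment_mean j : Er P (xi j) = 0.
Proof. by case: (moments j). Qed.

Lemma increment_cov j l : Er P (xi j \* xi l) = (t - s) *+ (j == l).
Proof.
have [<-|jl] := eqVneq j l.
  by case: (moments j) => _ _ ->; rewrite sqr_sqrtr// subr_ge0 ltW.
have [|||_ ->] := @ErM_indep _ _ _ P (xi j) (xi l).
- by move=> A B mA mB; exact: increments_indep.
- exact/Lfun2_subset_Lfun1/increment_Lfun2.
- exact/Lfun2_subset_Lfun1/increment_Lfun2.
by rewrite !increment_mean mul0r.
Qed.

(** [Z] and the [h j] are known at time [s] and the increment is independent of [F s]. Terms linear
    in the increment vanish because it is centred; among the quadratic ones its covariance keeps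
    only the diagonal. *)
Lemma one_step_isometry (Z : T -> R) (h : 'I_m -> T -> R) :
  measurable_fun [set: g_sigma_algebraType (F s)] Z -> Z \in Lfun P 2%:E ->
  (forall j, measurable_fun [set: g_sigma_algebraType (F s)] (h j)) ->
  (forall j, h j \in Lfun P 2%:E) ->
  let I w := \sum_j h j w * xi j w in
  I \in Lfun P 2%:E /\
  Er P (fun w => (Z w + I w) ^+ 2) =
  Er P (Z \* Z) + (t - s) * Er P (fun w => \sum_j h j w ^+ 2).
Proof.
move=> mZ Z2 mh h2 I.
have x2 := increment_Lfun2.
have mcoord (j : 'I_m) :
    measurable_fun [set: borelmx R m 1] (fun M : 'cV[R]_m => M j 0).
  by have /measurable_mxP := @measurable_id _ (borelmx R m 1) setT; exact.
have mM (f g : T -> R) : measurable_fun [set: g_sigma_algebraType (F s)] f ->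
    measurable_fun [set: g_sigma_algebraType (F s)] g ->
    measurable_fun [set: g_sigma_algebraType (F s)] (f \* g).
  by move=> mf mg; exact: measurable_funM.
have fxi (f : T -> R) j :
    measurable_fun [set: g_sigma_algebraType (F s)] f -> f \in Lfun P 1 ->
    f \* xi j \in Lfun P 1 /\ Er P (f \* xi j) = 0.
  move=> mf f1; have [|||fx1 ->] := @ErM_indep _ _ _ P f (xi j).
  - by move=> A B mA mB; exact: (increment_indep_past (g := fun M => M j 0)).
  - exact: f1.
  - exact: Lfun2_subset_Lfun1.
  by rewrite increment_mean mulr0.
have fxixi (f : T -> R) j l :
    measurable_fun [set: g_sigma_algebraType (F s)] f -> f \in Lfun P 1 ->
    f \* (xi j \* xi l) \in Lfun P 1 /\
    Er P (f \* (xi j \* xi l)) = Er P f * ((t - s) *+ (j == l)).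
  move=> mf f1; have [|||fx1 ->] := @ErM_indep _ _ _ P f (xi j \* xi l).
  - move=> A B mA mB; apply: (increment_indep_past (g := fun M => M j 0 * M l 0)) => //.
    exact: measurable_funM.
  - exact: f1.
  - exact: Lfun2_mul_Lfun1.
  by rewrite increment_cov.
(* Two square-integrable factors alone would only give an integrable product. Here the squares
   [(h j)^2] and [(xi j)^2] are integrable and independent, so their product is integrable. *)
have hx2 j : (fun w => h j w * xi j w) \in Lfun P 2%:E.
  apply: (@Lfun2_dominated _ _ _ _ _ ((h j \* h j) \* (xi j \* xi j))).
  - apply: measurable_funM; last exact: mxi.
    exact: Lfun_measurable (h2 j).
  - by move=> w /=; rewrite exprMn !expr2.
  - by have [] := fxixi _ j j (mM _ _ (mh j) (mh j)) (Lfun2_mul_Lfun1 (h2 j) (h2 j)).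
have I2 : I \in Lfun P 2%:E by apply: Lfun_sum => //; rewrite ler1n.
split=> //.
have Zh j := Lfun2_mul_Lfun1 Z2 (h2 j).
have hh j l := Lfun2_mul_Lfun1 (h2 j) (h2 l).
(* The square is sorted by degree in the increment: 0, 1, then 2. *)
have -> : (fun w => (Z w + I w) ^+ 2) = (fun w => Z w * Z w +
    (2 * (\sum_j Z w * h j w * xi j w) +
     \sum_j \sum_l h j w * h l w * (xi j w * xi l w))).
  apply/funext => w; rewrite sqrrD expr2 -addrA mulr2n mulrDl mul1r.
  congr (_ + _); congr (_ + _).
    by rewrite /I mulr_sumr; congr (_ + _); apply: eq_bigr => j _; rewrite mulrA.
  rewrite expr2 /I mulr_suml; apply: eq_bigr => j _; rewrite mulr_sumr.
  by apply: eq_bigr => l _; ring.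
have cross j := fxi _ j (mM _ _ mZ (mh j)) (Zh j).
have quad j l := fxixi _ j l (mM _ _ (mh j) (mh l)) (hh j l).
have S1 : (fun w => \sum_j Z w * h j w * xi j w) \in Lfun P 1.
  by apply: Lfun_sum => // j; have [] := cross j.
have S2j j : (fun w => \sum_l h j w * h l w * (xi j w * xi l w)) \in Lfun P 1.
  by apply: Lfun_sum => // l; have [] := quad j l.
have S2 : (fun w => \sum_j \sum_l h j w * h l w * (xi j w * xi l w)) \in Lfun P 1.
  exact: Lfun_sum.
rewrite ErD//; [|exact: Lfun2_mul_Lfun1|by apply: rpredD => //; exact: LfunZ].
rewrite ErD//; last exact: LfunZ.
rewrite ErZ// Er_sum => [|j]; last by have [] := cross j.
rewrite big1 ?mulr0 ?add0r => [|j _]; last by have [] := cross j.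
congr (_ + _); rewrite [LHS]Er_sum// [in RHS]Er_sum => [|j]; last exact: hh.
rewrite mulr_sumr.
apply: eq_bigr => j _; rewrite Er_sum => [|l]; last by have [] := quad j l.
rewrite (bigD1 j)//= big1 ?addr0 => [|l lj].
  by have [_ ->] := quad j j; rewrite eqxx mulr1n mulrC.
by have [_ ->] := quad j l; rewrite eq_sym (negbTE lj) mulr0n mulr0.
Qed.

End increments.

(** * Matrices *)

Section linear_algebra.
Context {R : realType}.

Let entryB {p q : nat} (A B : 'M[R]_(p, q)) i j : (A - B) i j = A i j - B i j.
Proof. by rewrite !mxE. Qed.

Lemma quad_id {p : nat} (v : 'cV[R]_p) : (v^T *m v) 0 0 = \sum_i v i 0 ^+ 2.
Proof. by rewrite mxE; apply: eq_bigr => i _; rewrite !mxE expr2. Qed.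

Lemma quad_id_ge0 {p : nat} (v : 'cV[R]_p) : 0 <= (v^T *m v) 0 0.
Proof. by rewrite quad_id; apply: sumr_ge0 => i _; exact: sqr_ge0. Qed.

Lemma quad_id_eq0 {p : nat} (v : 'cV[R]_p) : (v^T *m v) 0 0 <= 0 -> v = 0.
Proof.
move=> v0; have /eqP : (v^T *m v) 0 0 = 0 by apply/le_anti; rewrite v0 quad_id_ge0.
rewrite quad_id psumr_eq0 => [/allP h|i _]; last exact: sqr_ge0.
apply/matrixP => i j; rewrite ord1 mxE; apply/eqP.
by rewrite -sqrf_eq0; exact: (implyP (h i (mem_index_enum _))).
Qed.

Lemma unitmx_injective {p : nat} (A : 'M[R]_p) :
  (forall v : 'cV[R]_p, A *m v = 0 -> v = 0) -> A \in unitmx.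
Proof.
move=> A_inj; rewrite -unitmx_tr -row_free_unit -kermx_eq0.
apply/eqP/row_matrixP => i; rewrite row0; apply: trmx_inj; rewrite trmx0.
apply: A_inj; apply: trmx_inj; rewrite trmx_mul trmxK trmx0.
by rewrite -row_mul mulmx_ker row0.
Qed.

Lemma unitmx_quad_gt0 {p : nat} (A : 'M[R]_p) (c : R) : 0 < c ->
  (forall v : 'cV[R]_p, c * (v^T *m v) 0 0 <= (v^T *m A *m v) 0 0) -> A \in unitmx.
Proof.
move=> c0 cA; apply: unitmx_injective => v Av0; apply: quad_id_eq0.
by have := cA v; rewrite -mulmxA Av0 mulmx0 [leRHS]mxE pmulr_rle0.
Qed.

(* With v = A w, this is 0 <= |w - A^T v|^2 = |w|^2 - 2 |v|^2 + |A^T v|^2. *)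
Lemma expanding_trmx {p : nat} (A : 'M[R]_p) :
  (forall w : 'cV[R]_p, (w^T *m w) 0 0 <= ((A *m w)^T *m (A *m w)) 0 0) ->
  forall v : 'cV[R]_p, (v^T *m v) 0 0 <= ((A^T *m v)^T *m (A^T *m v)) 0 0.
Proof.
move=> Aw v.
(* An expanding square matrix is injective, hence invertible, so every [v] has the form [A w]. *)
have uA : A \in unitmx.
  apply: unitmx_injective => w Aw0; apply: quad_id_eq0.
  by rewrite (le_trans (Aw w))// Aw0 mulmx0 mxE.
pose w := invmx A *m v; have vE : A *m w = v by rewrite mulKVmx.
have := Aw w; rewrite vE => wv.
have := quad_id_ge0 (w - A^T *m v).
rewrite [(_ - _)^T]linearB/= mulmxBl !mulmxBr (trmx_mul A^T v) trmxK.
have -> : w^T *m (A^T *m v) = v^T *m v by rewrite mulmxA -trmx_mul vE.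
have -> : v^T *m A *m w = v^T *m v by rewrite -mulmxA vE.
by rewrite !entryB; lra.
Qed.

Lemma loewner_ge_scalar {p : nat} (A : 'M[R]_p) (c : R) : A^T = A ->
  (forall v : 'cV[R]_p, c * (v^T *m v) 0 0 <= (v^T *m A *m v) 0 0) ->
  loewner_ge A c%:M.
Proof.
move=> As cA; split=> [|v]; first by rewrite linearB/= As tr_scalar_mx.
rewrite mulmxBr mulmxBl mul_mx_scalar -scalemxAl.
by rewrite entryB [X in _ - X]mxE subr_ge0.
Qed.

Lemma loewner_ge_scalarE {p : nat} (A : 'M[R]_p) (c : R) : loewner_ge A c%:M ->
  forall v : 'cV[R]_p, c * (v^T *m v) 0 0 <= (v^T *m A *m v) 0 0.
Proof.
move=> [_ +] v => /(_ v); rewrite mulmxBr mulmxBl mul_mx_scalar -scalemxAl.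
by rewrite entryB [X in _ - X]mxE subr_ge0.
Qed.

(* V = U + M with M U^T = 0, so that |V^T w|^2 = |w|^2 + |M^T w|^2. *)
Lemma R_factor_expanding {d k : nat} (C : 'M[R]_k) (G U V Q : 'M[R]_(k, d))
    (Rm : 'M[R]_k) (c : R) :
  C \in unitmx -> U *m U^T = 1%:M ->
  C *m V = C *m U + c *: (G *m (1%:M - U^T *m U)) ->
  V^T = Q^T *m Rm -> Q *m Q^T = 1%:M ->
  forall w : 'cV[R]_k, (w^T *m w) 0 0 <= ((Rm *m w)^T *m (Rm *m w)) 0 0.
Proof.
move=> uC UU CV VQ QQ w.
pose M := c *: (invmx C *m G *m (1%:M - U^T *m U)).
have VE : V = U + M.
  by rewrite -[V](mulKmx uC) CV mulmxDr mulKmx// -scalemxAr !mulmxA.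
(* The projector [1 - U^T U] annihilates [U^T], since the rows of [U] are orthonormal. *)
have MU : M *m U^T = 0.
  rewrite /M -scalemxAl -(mulmxA _ _ U^T) mulmxBl mul1mx -(mulmxA U^T U) UU.
  by rewrite mulmx1 subrr mulmx0 scaler0.
have UM : U *m M^T = 0 by apply: trmx_inj; rewrite trmx_mul trmxK MU trmx0.
have VV : V *m V^T = 1%:M + M *m M^T.
  by rewrite VE [(_ + _)^T]linearD/= mulmxDl !mulmxDr UU MU UM addr0 add0r.
have -> : (Rm *m w)^T *m (Rm *m w) = w^T *m w + (M^T *m w)^T *m (M^T *m w).
  (* [V^T w = Q^T Rm w] has the length of [Rm w], because [Q] has orthonormal rows. *)
  transitivity (w^T *m (V *m V^T) *m w).
    have VQ' : V = Rm^T *m Q by rewrite -[V]trmxK VQ trmx_mul trmxK.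
    by rewrite VQ VQ' trmx_mul !mulmxA -(mulmxA _ Q) QQ mulmx1.
  by rewrite VV mulmxDr mulmx1 mulmxDl !trmx_mul trmxK !mulmxA.
by rewrite [leRHS]mxE lerDl quad_id_ge0.
Qed.

Lemma normF_sqr {p q : nat} (A : 'M[R]_(p, q)) :
  normF A ^+ 2 = \sum_i \sum_j A i j ^+ 2.
Proof.
rewrite sqr_sqrtr//; apply: sumr_ge0 => i _; apply: sumr_ge0 => j _.
exact: sqr_ge0.
Qed.

Lemma sqr_coef_le_normF {p q : nat} (A : 'M[R]_(p, q)) i j :
  A i j ^+ 2 <= normF A ^+ 2.
Proof.
rewrite normF_sqr (bigD1 i)//= (bigD1 j)//= -addrA lerDl addr_ge0//.
  by apply: sumr_ge0 => *; exact: sqr_ge0.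
by apply: sumr_ge0 => *; apply: sumr_ge0 => *; exact: sqr_ge0.
Qed.

End linear_algebra.

(** * Measurability and second moments of matrix-valued maps *)

Section matrix_valued.
Context {R : realType}.

Lemma measurable_mulmx {dd} {T : measurableType dd} {p q r : nat}
    (M : 'M[R]_(p, q)) (f : T -> 'M[R]_(q, r)) :
  (forall i j, measurable_fun [set: T] (fun w => f w i j)) ->
  forall i j, measurable_fun [set: T] (fun w => (M *m f w) i j).
Proof.
move=> mf i j; under eq_fun do rewrite mxE.
by apply: measurable_sum => l; apply: measurable_funM.
Qed.

(** Joint measurability in time and space is used at a frozen time: the preimage of a Borel set
    under [f t] is a section of a measurable set of the product. *)
Lemma measurable_borel_coef {dd} {T : measurableType dd} {d p q : nat}
    (f : R -> 'cV[R]_d -> 'M[R]_(p, q)) (t : R) (X : T -> 'cV[R]_d) :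
  borel_coef f -> 0 <= t ->
  (forall i j, measurable_fun [set: T] (fun w => X w i j)) ->
  forall i j, measurable_fun [set: T] (fun w => f t (X w) i j).
Proof.
move=> mf t0 /measurable_mxP mX; apply/measurable_mxP => _ B mB; rewrite setTI.
have mD : measurable ([set t : R | 0 <= t] `*` [set: borelmx R d 1]).
  by apply: measurableX => //; rewrite -set_itvcy; exact: measurable_itv.
have /measurable_xsection := mf mD B mB.
move=> /(_ t) /(mX measurableT); rewrite setTI; congr measurable.
apply/seteqP; split=> w /=; rewrite /xsection/= inE/=; first by case.
by move=> fB; split.
Qed.

Context {dd} {T : measurableType dd} (P : probability T R).

Lemma Lfun_mulmx {p q r : nat} (M : 'M[R]_(p, q)) (f : T -> 'M[R]_(q, r)) :
  (forall i j, (fun w => f w i j) \in Lfun P 2%:E) ->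
  forall i j, (fun w => (M *m f w) i j) \in Lfun P 2%:E.
Proof.
move=> f2 i j; under eq_fun do rewrite mxE.
by apply: Lfun_sum => [|l]; [rewrite ler1n|apply: LfunZ; [rewrite ler1n|]].
Qed.

Lemma Lfun1_normF_sqr {p q : nat} (X : T -> 'M[R]_(p, q)) :
  (forall i j, (fun w => X w i j) \in Lfun P 2%:E) ->
  (fun w => normF (X w) ^+ 2) \in Lfun P 1.
Proof.
move=> X2; under eq_fun do rewrite normF_sqr.
by apply: Lfun_sum => // i; apply: Lfun_sum => // j; exact: Lfun2_mul_Lfun1.
Qed.

Lemma L2_Lfun2 {k : nat} (Y : T -> 'cV[R]_k) : L2 P Y ->
  forall i j, (fun w => Y w i j) \in Lfun P 2%:E.
Proof.
move=> [mY Y2] i j.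
have mYc : forall i j, measurable_fun [set: T] (fun w => Y w i j).
  by apply/measurable_mxP => _ B mB; rewrite setTI; exact: mY.
apply: (@Lfun2_dominated _ _ _ _ _ (fun w => normF (Y w) ^+ 2)) => //.
  by move=> w; exact: sqr_coef_le_normF.
apply/Lfun1_integrable/integrableP; split.
  apply/measurable_EFinP; under eq_fun do rewrite normF_sqr.
  apply: measurable_sum => l; apply: measurable_sum => l'.
  by apply: measurable_funX; exact: mYc.
move: Y2; rewrite unlock; apply: le_lt_trans.
by under eq_integral do rewrite gee0_abs ?lee_fin ?sqr_ge0//.
Qed.

Lemma C_sym {k : nat} (Y : T -> 'cV[R]_k) : (C_ P Y)^T = C_ P Y.
Proof.
apply/matrixP => i j; rewrite !mxE; congr fine; congr expectation.
by apply/funext => w; rewrite !mxE; apply: eq_bigr => l _; rewrite !mxE mulrC.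
Qed.

(** Reduces a Loewner bound on the second moment matrix to scalar second moments, one direction at a
    time; square integrability lets the expectation pass through the double sum. *)
Lemma quad_C_ {k : nat} (Y : T -> 'cV[R]_k) (v : 'cV[R]_k) :
  (forall i j, (fun w => Y w i j) \in Lfun P 2%:E) ->
  (v^T *m C_ P Y *m v) 0 0 = Er P (fun w => (v^T *m Y w) 0 0 ^+ 2).
Proof.
move=> Y2.
have YY i j := Lfun2_mul_Lfun1 (Y2 i 0) (Y2 j 0).
have C_E i j : C_ P Y i j = Er P (fun w => Y w i 0 * Y w j 0).
  rewrite mxE; congr fine; congr expectation; apply/funext => w.
  by rewrite mxE big_ord1 mxE.
have -> : (fun w => (v^T *m Y w) 0 0 ^+ 2) =
    (fun w => \sum_j \sum_i (v i 0 * v j 0) * (Y w i 0 * Y w j 0)).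
  apply/funext => w; rewrite expr2 mxE mulr_suml exchange_big/=.
  apply: eq_bigr => i _; rewrite mulr_sumr; apply: eq_bigr => j _.
  by rewrite !mxE; ring.
rewrite Er_sum => [|j]; last first.
  by apply: Lfun_sum => // i; apply: LfunZ => //; exact: YY.
rewrite mxE; apply: eq_bigr => j _.
rewrite Er_sum => [|i]; last by apply: LfunZ => //; exact: YY.
rewrite mxE mulr_suml; apply: eq_bigr => i _.
by rewrite ErZ; [rewrite C_E mxE; ring|exact: YY].
Qed.

End matrix_valued.

(** * One step of the scheme *)

Section one_step.
Context {R : realType} {disp : measure_display} {Omega : measurableType disp}.
Context (P : probability Omega R) (F : R -> set (set Omega)).
Context {d m k : nat} (W : R -> Omega -> 'cV[R]_m).
Context (a : R -> 'cV[R]_d -> 'cV[R]_d) (b : R -> 'cV[R]_d -> 'M[R]_(d, m)).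
Hypotheses (hF : filtration F) (hW : brownian_motion P F W).
Hypotheses (ha : borel_coef a) (hb : borel_coef b).
Context (Clgb : R).
Hypothesis hlgb : forall (s : R) (x : 'cV[R]_d), 0 <= s ->
  normF (a s x) ^+ 2 + normF (b s x) ^+ 2 <= Clgb * (1 + normF x ^+ 2).
Context (sigmaB : R).
Hypothesis hsigmaB : forall (s : R) (x : 'cV[R]_d), 0 <= s ->
  loewner_ge (b s x *m (b s x)^T) sigmaB%:M.
Context (s t : R) (s0 : 0 <= s) (st : s < t).
Context (U : 'M[R]_(k, d)) (Y : Omega -> 'cV[R]_k).
Hypothesis UU : U *m U^T = 1%:M.
Hypothesis mY : forall i j,
  measurable_fun [set: g_sigma_algebraType (F s)] (fun w => Y w i j).
Hypothesis Y2 : forall i j, (fun w => Y w i j) \in Lfun P 2%:E.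

Let X w := U^T *m Y w.

Let X2 i j : (fun w => X w i j) \in Lfun P 2%:E.
Proof. exact: Lfun_mulmx. Qed.

Let Fs_measurable (f : Omega -> R) :
  measurable_fun [set: g_sigma_algebraType (F s)] f -> measurable_fun [set: Omega] f.
Proof. by apply: measurable_fun_sub_sigma; case: hF => _ + _; exact. Qed.

(** The integrable majorant that the linear growth bound supplies for the squared entries of [a] and
    [b]. *)
Let growth1 : (fun w => Clgb * (1 + normF (X w) ^+ 2)) \in Lfun P 1.
Proof.
apply: LfunZ => //; apply: LfunD => //; last exact: Lfun1_normF_sqr.
exact: (Lfun_cst P 1 1).
Qed.

Let ma i j : measurable_fun [set: g_sigma_algebraType (F s)] (fun w => a s (X w) i j).
Proof. by apply: (measurable_borel_coef ha s0); exact: measurable_mulmx. Qed.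

Let mb i j : measurable_fun [set: g_sigma_algebraType (F s)] (fun w => b s (X w) i j).
Proof. by apply: (measurable_borel_coef hb s0); exact: measurable_mulmx. Qed.

Let a2 i j : (fun w => a s (X w) i j) \in Lfun P 2%:E.
Proof.
apply: Lfun2_dominated growth1; first exact: Fs_measurable.
move=> w; apply: le_trans (hlgb (X w) s0).
by rewrite (le_trans (sqr_coef_le_normF _ i j))// lerDl sqr_ge0.
Qed.

Let b2 i j : (fun w => b s (X w) i j) \in Lfun P 2%:E.
Proof.
apply: Lfun2_dominated growth1; first exact: Fs_measurable.
move=> w; apply: le_trans (hlgb (X w) s0).
by rewrite (le_trans (sqr_coef_le_normF _ i j))// lerDr sqr_ge0.
Qed.

Section direction.
Variable v : 'cV[R]_k.

(** [Z] collects what is known at time [s], and [h] the weights of the noise coordinates: the shape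
    that [one_step_isometry] expects. *)
Let Z w := (v^T *m Y w) 0 0 + (t - s) * ((v^T *m U) *m a s (X w)) 0 0.
Let h j w := ((v^T *m U) *m b s (X w)) 0 j.

Let YtildeE w : (v^T *m Ytilde a b W s t U Y w) 0 0 =
  Z w + \sum_j h j w * (W t w - W s w) j 0.
Proof.
rewrite /Ytilde; move: (W t w - W s w) => dW.
rewrite !mulmxDr -scalemxAr !mulmxA mxE; congr (_ + _).
  by rewrite mxE [X in _ + X]mxE.
by rewrite mxE.
Qed.

Let mZ : measurable_fun [set: g_sigma_algebraType (F s)] Z.
Proof.
apply: measurable_funD; first exact: measurable_mulmx.
by apply: measurable_funM => //; exact: measurable_mulmx.
Qed.

Let Z2 : Z \in Lfun P 2%:E.
Proof.
have p1 : (1 <= 2 :> R) by rewrite ler1n.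
apply: LfunD => //; first exact: Lfun_mulmx.
by apply: LfunZ => //; exact: Lfun_mulmx.
Qed.

Let mh j : measurable_fun [set: g_sigma_algebraType (F s)] (h j).
Proof. exact: measurable_mulmx. Qed.

Let h2 j : h j \in Lfun P 2%:E.
Proof. exact: Lfun_mulmx. Qed.

Lemma Ytilde_Lfun2 : (fun w => (v^T *m Ytilde a b W s t U Y w) 0 0) \in Lfun P 2%:E.
Proof.
have [I2 _] := one_step_isometry hF hW s0 st mZ Z2 mh h2.
under eq_fun do rewrite YtildeE.
by apply: LfunD => //; rewrite ler1n.
Qed.

Lemma measurable_Ytilde :
  measurable_fun [set: g_sigma_algebraType (F t)]
    (fun w => (v^T *m Ytilde a b W s t U Y w) 0 0).
Proof.
have Fst : F s `<=` F t by case: hF => _ _; apply => //; exact: ltW.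
under eq_fun do rewrite YtildeE.
apply: measurable_funD; first exact: measurable_fun_mono_sigma mZ.
apply: measurable_sum => j; apply: measurable_funM.
  exact: measurable_fun_mono_sigma (mh j).
exact: (measurable_increment hF hW s0 st).
Qed.

Lemma Ytilde_coercive :
  sigmaB * (t - s) * (v^T *m v) 0 0 <=
  Er P (fun w => (v^T *m Ytilde a b W s t U Y w) 0 0 ^+ 2).
Proof.
have [_ E] := one_step_isometry hF hW s0 st mZ Z2 mh h2.
under eq_fun do rewrite YtildeE.
rewrite E; have ZZ0 : 0 <= Er P (Z \* Z) by apply: Er_ge0 => w; exact: sqr_ge0.
rewrite -[leLHS]add0r lerD// mulrAC (mulrC _ (t - s)) ler_pM2l ?subr_gt0//.
(* Written as the expectation of a constant, so that a pointwise bound suffices. *)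
have -> : sigmaB * (v^T *m v) 0 0 = Er P (cst (sigmaB * (v^T *m v) 0 0)).
  by rewrite /Er expectation_cst.
apply: Er_le => [||w]; first exact: (Lfun_cst P _ 1).
  by apply: Lfun_sum => // j; exact: Lfun2_mul_Lfun1.
(* Ellipticity is tested at [U^T v], which is as long as [v] because [U U^T = 1]. *)
have := loewner_ge_scalarE (hsigmaB (X w) s0) (U^T *m v).
rewrite trmx_mul trmxK !mulmxA -(mulmxA v^T U) UU mulmx1 => /le_trans; apply.
have -> : v^T *m U *m b s (X w) *m (b s (X w))^T *m U^T *m v =
    (v^T *m U *m b s (X w)) *m (v^T *m U *m b s (X w))^T.
  by rewrite !trmx_mul !trmxK !mulmxA.
by rewrite mxE ler_sum// => j _; rewrite [X in _ * X]mxE -expr2.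
Qed.

End direction.
End one_step.

(** * Induction along the time grid *)

Theorem proposition4p1
  (R : realType)
  (disp : measure_display) (Omega : measurableType disp)
  (P : probability Omega R) (F : R -> set (set Omega))
  (hF : filtration F) (hFu : usual_conditions P F)
  (d m k : nat) (hk : (1 <= k)%N) (hkd : (k <= d)%N)
  (W : R -> Omega -> 'cV[R]_m) (hW : brownian_motion P F W)
  (a : R -> 'cV[R]_d -> 'cV[R]_d) (b : R -> 'cV[R]_d -> 'M[R]_(d, m))
  (ha : borel_coef a) (hb : borel_coef b)
  (haL : lipschitz_coef a) (hbL : lipschitz_coef b)
  (Clgb : R)
  (hlgb : forall (s : R) (x : 'cV[R]_d), 0 <= s ->
     normF (a s x) ^+ 2 + normF (b s x) ^+ 2 <= Clgb * (1 + normF x ^+ 2))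
  (T : R) (hT : 0 < T) (N : nat) (t : nat -> R) (ht : time_grid T N t)
  (U : nat -> 'M[R]_(k, d)) (Y : nat -> Omega -> 'cV[R]_k)
  (hUY : DLR_Euler_Maruyama P a b W F N t U Y)
  (sigma0 : R) (hsigma0 : smallest_eigenvalue (C_ P (Y 0%N)) sigma0)
  (hsigma0_gt0 : 0 < sigma0)
  (sigmaB : R) (hsigmaB_gt0 : 0 < sigmaB)
  (hsigmaB : forall (s : R) (x : 'cV[R]_d), 0 <= s ->
     loewner_ge (b s x *m (b s x)^T) (sigmaB%:M)) :
  forall n : nat, (n < N)%N ->
    loewner_ge (C_ P (Y n.+1)) ((sigmaB * (t n.+1 - t n))%:M).

Proof.
have [F_sigma _ _] := hF.
have [grid0 _ grid_lt] := ht.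
have [U0 Y0 mY0 step] := hUY.
have t_ge0 n : (n <= N)%N -> 0 <= t n.
  elim: n => [|n IHn] nN; first by rewrite grid0.
  by rewrite (le_trans (IHn (ltnW nN)))// ltW// grid_lt.
(* Adaptedness and square integrability feed the isometry, orthonormality and invertibility the
   comparison of [Rm] with the identity. *)
pose inv n := [/\ U n *m (U n)^T = 1%:M,
  forall i j, measurable_fun [set: g_sigma_algebraType (F (t n))] (fun w => Y n w i j),
  forall i j, (fun w => Y n w i j) \in Lfun P 2%:E & C_ P (Y n) \in unitmx].
(* The invariant and the bound are proved together, because the bound at [n.+1] is what makes the
   next second moment matrix invertible. *)
have inv_step n : (n < N)%N -> inv n -> inv n.+1 /\
    loewner_ge (C_ P (Y n.+1)) ((sigmaB * (t n.+1 - t n))%:M).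
  move=> nN [UU mY Y2 CU].
  have [V [Rm [[VE _] [VQ QQ _ _] YE]]] := step n nN.
  have tn0 := t_ge0 n (ltnW nN); have tlt := grid_lt n nN.
  have Yv (v : 'cV[R]_k) w : (v^T *m Y n.+1 w) 0 0 =
      ((Rm^T *m v)^T *m Ytilde a b W (t n) (t n.+1) (U n) (Y n) w) 0 0.
    by rewrite YE trmx_mul trmxK mulmxA.
  (* Entries are read as basis directions, so that the results on [v^T Ytilde] also give
     integrability and adaptedness of each entry. *)
  have Ycoef i j w : Y n.+1 w i j = ((delta_mx i 0 : 'cV[R]_k)^T *m Y n.+1 w) 0 0.
    by rewrite trmx_delta -rowE mxE ord1.
  have Y2' i j : (fun w => Y n.+1 w i j) \in Lfun P 2%:E.
    under eq_fun do rewrite Ycoef Yv.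
    exact: (Ytilde_Lfun2 hF hW ha hb hlgb tn0 tlt (U n) mY Y2).
  have coercive (v : 'cV[R]_k) : sigmaB * (t n.+1 - t n) * (v^T *m v) 0 0 <=
      (v^T *m C_ P (Y n.+1) *m v) 0 0.
    rewrite quad_C_//; under eq_fun do rewrite Yv.
    apply: le_trans (Ytilde_coercive hF hW ha hb hlgb hsigmaB tn0 tlt UU mY Y2 _).
    rewrite ler_pM2l ?mulr_gt0 ?subr_gt0//; apply: expanding_trmx.
    exact: (R_factor_expanding CU UU VE VQ QQ).
  split; last by apply: loewner_ge_scalar => //; exact: C_sym.
  split=> //; last by apply: unitmx_quad_gt0 coercive; rewrite mulr_gt0 ?subr_gt0.
  move=> i j; under eq_fun do rewrite Ycoef Yv.
  exact: (measurable_Ytilde hF hW ha hb tn0 tlt (U n) mY).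
have inv0 : inv 0%N.
  split=> //.
  - by rewrite grid0; apply/measurable_wrtP => //; exact: F_sigma.
  - exact: L2_Lfun2.
  (* A nonzero kernel vector would make 0 an eigenvalue, below the least one [sigma0 > 0].
     Eigenvectors are rows here, so the witness is [v^T], and symmetry moves the matrix to the other
     side. *)
  - apply: unitmx_injective => v Cv0; apply/eqP/negPn/negP => v_neq0.
    have [_ /(_ 0)] := hsigma0; rewrite leNgt hsigma0_gt0 => /(_ _)/negP; apply => //.
    apply/eigenvalueP; exists v^T; last by rewrite trmx_eq0.
    by rewrite scale0r -[C_ _ _]trmxK C_sym -trmx_mul Cv0 trmx0.
have invn n : (n <= N)%N -> inv n.
  by elim: n => [//|n IHn] nN; have [] := inv_step n nN (IHn (ltnW nN)).
by move=> n nN; have [] := inv_step n nN (invn n (ltnW nN)).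
Qed.
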